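(* Let $A$ be a regular ring containing a field of characteristic zero, let $m\ge 1$, and let $R=A[X_1,\ldots,X_m]$ be graded by $\deg A=0$ and $\deg X_i=1$ for all $i$. Let $I$ be a homogeneous ideal of $R$, let $i\ge 0$, and let $M=H^i_I(R)=\bigoplus_{n\in\mathbb{Z}}M_n$. If $M_n=0$ for all $|n|\gg 0$, then $M=0$.
   Context: Regular rings are commutative and Noetherian. $H^i_I(R)$ denotes the $i$-th local cohomology module of $R$ with support in $I$; it is a graded $R$-module, and $M_n$ is its degree $n$ component, which is an $A$-module. *)

(* Defs.v *)
From HB Require Import structures.
From mathcomp Require Import all_boot all_order all_algebra.
From mathcomp Require Import mpoly.

Set Implicit Arguments.
Unset Strict Implicit.
Unset Printing Implicit Defensive.

Import Order.TTheory GRing.Theory Num.Theory.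
Local Open Scope ring_scope.

(* Ideals are Prop-valued predicates, and may be the whole ring: the ideals of
   ring_quotient are decidable and proper. *)

Section Ideals.
Variable R : comNzRingType.
Implicit Types I J P : R -> Prop.

Definition is_ideal I : Prop :=
  [/\ I 0, forall x y, I x -> I y -> I (x + y) & forall a x, I x -> I (a * x)].

Definition prime_ideal P : Prop :=
  [/\ is_ideal P, ~ P 1 & forall x y, P (x * y) -> P x \/ P y].

Definition maximal_ideal I : Prop :=
  [/\ is_ideal I, ~ I 1 &
      forall J, is_ideal J -> ~ J 1 -> (forall x, I x -> J x) ->
        forall x, J x -> I x].

Definition generates (n : nat) (g : 'I_n -> R) I : Prop :=
  forall x, I x <-> exists c : 'I_n -> R, x = \sum_(j < n) c j * g j.

Definition noetherian : Prop :=
  forall I, is_ideal I -> exists n (g : 'I_n -> R), generates g I.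

Definition ideal_mul I J (x : R) : Prop :=
  exists n (a b : 'I_n -> R),
    [/\ forall j, I (a j), forall j, J (b j) & x = \sum_(j < n) a j * b j].

Fixpoint ideal_exp I (k : nat) : R -> Prop :=
  if k is k'.+1 then ideal_mul I (ideal_exp I k') else fun=> True.

Definition has_prime_chain (d : nat) : Prop :=
  exists P : nat -> R -> Prop,
    (forall j, (j <= d)%N -> prime_ideal (P j)) /\
    (forall j, (j < d)%N ->
       (forall x, P j x -> P j.+1 x) /\ exists2 x, P j.+1 x & ~ P j x).

Definition krull_dim (d : nat) : Prop :=
  has_prime_chain d /\ ~ has_prime_chain d.+1.

Definition min_generators I (d : nat) : Prop :=
  (exists g : 'I_d -> R, generates g I) /\
  (forall n (g : 'I_n -> R), generates g I -> (d <= n)%N).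

Definition regular_local : Prop :=
  noetherian /\
  exists mm : R -> Prop,
    [/\ maximal_ideal mm,
        forall J, maximal_ideal J -> forall x, J x <-> mm x &
        exists d, krull_dim d /\ min_generators mm d].

End Ideals.

(* [f : A -> L] exhibits L as the localization of A at the prime P. *)
Definition is_localization (A L : comNzRingType) (P : A -> Prop)
    (f : {rmorphism A -> L}) : Prop :=
  [/\ forall s, ~ P s -> exists y, f s * y = 1,
      forall z, exists a s, ~ P s /\ z * f s = f a &
      forall a, f a = 0 <-> exists2 s, ~ P s & s * a = 0].

Definition regular_ring (A : comNzRingType) : Prop :=
  noetherian A /\
  forall P : A -> Prop, prime_ideal P ->
    exists (L : comNzRingType) (f : {rmorphism A -> L}),
      is_localization P f /\ regular_local L.

Definition contains_field_char0 (A : comNzRingType) : Prop :=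
  exists (K : fieldType) (_ : {rmorphism K -> A}), [pchar K] =i pred0.

Section Graded.
Variables (A : comNzRingType) (m : nat).
Local Notation R := {mpoly A[m]}.

Definition homogeneous_ideal (I : R -> Prop) : Prop :=
  is_ideal I /\ forall p, I p -> forall d : nat, I (pihomog mdeg d p).

Definition is_grading (M : lmodType R) (G : int -> M -> Prop) : Prop :=
  [/\ forall n, G n 0 /\ (forall x y, G n x -> G n y -> G n (x - y)),
      forall (d : nat) (p : R) n x,
        p \is d.-homog -> G n x -> G (d%:Z + n) (p *: x),
      forall x, exists (s : seq int) (c : int -> M),
        [/\ uniq s, forall n, G n (c n) & x = \sum_(n <- s) c n] &
      forall (s : seq int) (c : int -> M),
        uniq s -> (forall n, G n (c n)) -> \sum_(n <- s) c n = 0 ->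
        forall n, n \in s -> c n = 0].

Record grmod := GrMod {
  gr_sort :> lmodType R;
  gr_comp : int -> gr_sort -> Prop;
  gr_compP : is_grading gr_comp }.

Definition graded_hom (M N : grmod) (f : M -> N) : Prop :=
  forall n x, gr_comp n x -> gr_comp n (f x).

Definition poly_comp (n : int) (p : R^o) : Prop :=
  match n with
  | Posz d => (p : R) \is d.-homog
  | Negz _ => p = 0
  end.

Lemma poly_comp_grading : is_grading poly_comp.
Proof.
split.
- case=> d /=; split=> //.
  + exact: dhomog0.
  + by move=> x y hx hy; apply: rpredB.
  + by move=> x y -> ->; rewrite subr0.
- move=> d p [e|e] x hp /=; first by move=> hx; apply: dhomogM.
  move=> ->; rewrite scaler0; case: (_ + _) => // k /=; exact: dhomog0.
- move=> x; exists [seq Posz k | k <- iota 0 (msize (x : R))].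
  exists (fun n : int => if n is Posz d then pihomog mdeg d (x : R) else 0).
  split.
  + by rewrite map_inj_uniq ?iota_uniq // => a b [].
  + by case=> d //=; apply: pihomogP.
  + rewrite big_map -{1}[msize _]subn0 -/(index_iota 0 _) big_mkord.
    exact: pihomog_partitionE.
- move=> s c us hc h0 [d|d] hd; last by have := hc (Negz d).
  have : pihomog mdeg d (\sum_(n <- s) c n : R) = 0 by rewrite h0 raddf0.
  rewrite raddf_sum (bigD1_seq (Posz d)) //= big1_seq ?addr0.
    by rewrite pihomog_dE //; apply: (hc (Posz d)).
  case=> [e|e] /andP[ne _]; last by rewrite (hc (Negz e) : _ = 0) raddf0.
  apply: (@pihomog_ne0 _ _ mdeg e); last exact: (hc (Posz e)).
  by apply: contraNneq ne => ->.
Qed.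

Definition poly_grmod : grmod := GrMod poly_comp_grading.

(* Injectivity in the category of graded modules and degree-0 maps. *)
Definition graded_injective (E : grmod) : Prop :=
  forall (M N : grmod) (f : {linear M -> N}) (g : {linear M -> E}),
    graded_hom f -> injective f -> graded_hom g ->
    exists2 h : {linear N -> E}, graded_hom h & forall x, h (f x) = g x.

Definition graded_injective_resolution (N : grmod) (E : nat -> grmod)
    (eps : {linear N -> E 0}) (d : forall k, {linear E k -> E k.+1}) : Prop :=
  [/\ forall k, graded_injective (E k),
      graded_hom eps /\ (forall k, graded_hom (d k)),
      injective eps,
      forall x, d 0 x = 0 <-> exists y, eps y = x &
      forall k x, d k.+1 x = 0 <-> exists y, d k y = x].

Definition torsion (I : R -> Prop) (M : lmodType R) (x : M) : Prop :=
  exists k, forall p, ideal_exp I k p -> p *: x = 0.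

Section TorsionComplex.
Variables (I : R -> Prop) (E : nat -> grmod).
Variable d : forall k, {linear E k -> E k.+1}.

Definition torsion_cocycle (i : nat) (x : E i) : Prop :=
  torsion I x /\ d i x = 0.

Definition torsion_coboundary (i : nat) : E i -> Prop :=
  match i with
  | 0 => fun x => x = 0
  | j.+1 => fun x => exists2 y : E j, torsion I y & d j y = x
  end.

End TorsionComplex.

(* [H] is the i-th graded right derived functor of the I-torsion functor at N:
   [pi], of which only the values on cocycles matter, identifies H, with its
   grading, with the i-th cohomology module of the I-torsion subcomplex of a
   graded injective resolution of N. *)
Definition is_local_cohomology (I : R -> Prop) (i : nat) (N H : grmod) : Prop :=
  exists (E : nat -> grmod) (eps : {linear N -> E 0})
         (d : forall k, {linear E k -> E k.+1}) (pi : E i -> H),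
    graded_injective_resolution eps d /\
    [/\ forall (a : R) x y,
          torsion_cocycle I d x -> torsion_cocycle I d y ->
          pi (a *: x + y) = a *: pi x + pi y,
        forall z, exists2 x, torsion_cocycle I d x & pi x = z,
        forall x, torsion_cocycle I d x ->
          (pi x = 0 <-> torsion_coboundary I d x) &
        forall n z, gr_comp n z <->
          exists x, [/\ torsion_cocycle I d x, gr_comp n x & pi x = z]].

End Graded.

(* Main.v *)
Require Import Defs.
From HB Require Import structures.
From mathcomp Require Import all_boot all_order all_algebra.
From mathcomp Require Import mpoly.
From mathcomp Require Import zify.
From mathcomp Require boolp.

Set Implicit Arguments.
Unset Strict Implicit.
Unset Printing Implicit Defensive.

Import Order.TTheory GRing.Theory Num.Theory.
Local Open Scope ring_scope.

(** The partial derivative d/dX_j of R = A[X_1, ..., X_m] acts on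
    M = H^i_I(R) by an additive operator D with D (p x) = p (D x) + (dp/dX_j) x:
    this is the part of the structure of a module over the Weyl algebra that the
    argument uses. If only finitely many degrees of M are nonzero, X_j^k kills M
    for some k, because X_j raises degrees by 1. Applying D to X_j^k x = 0
    gives k X_j^(k-1) x = 0, hence X_j^(k-1) x = 0 in characteristic 0, and
    descending on k gives 1 x = 0 ([derivation_nilpotent_eq0]). The variable
    X_j exists because m >= 1.

    The substance is the existence of D ([local_cohomology_derivation]) when M
    is computed from a graded injective resolution E of R. The derivative is
    extended to derivations D_k of the E_k that commute with the differentials,
    one k at a time. On the image of E_k in E_(k+1) the value of D_(k+1) is
    forced, and the question is to extend a derivation from a graded submodule
    of an injective module to the whole module ([derivation_extend]). A
    derivation of E is the same thing as a linear section of the jet module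
    J(E) = E (+) E, on which p acts by p (a, b) = (p a, p b + (dp/dX_j) a). If D
    is defined on a submodule N, then (a, b) |-> b - D a is linear on the jets
    whose first component lies in N; an R-linear extension h to J(E) restricts
    to the identity on 0 (+) E, and x |-> - h (x, 0) is a derivation extending
    D. Finally, a derivation preserves I-torsion: if I^k kills x, then I^(k+1)
    kills D x. The D_k therefore act on the torsion complex and its
    cohomology. *)

(** * Gradings *)

Lemma sum_extend (V : nmodType) (s u : seq int) (c : int -> V) :
  uniq s -> uniq u -> {subset s <= u} ->
  \sum_(n <- u) (if n \in s then c n else 0) = \sum_(n <- s) c n.
Proof.
move=> us uu su; rewrite -big_mkcond -big_filter.
apply/perm_big/uniq_perm => [||n]; rewrite ?filter_uniq // mem_filter.
by apply/andb_idr/su.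
Qed.

Definition decomposable (V : nmodType) (G : int -> V -> Prop) (x : V) : Prop :=
  exists (s : seq int) (c : int -> V),
    [/\ uniq s, forall n, G n (c n) & x = \sum_(n <- s) c n].

(** Existence of homogeneous decompositions need only be checked on a set of
    additive generators. *)
Lemma decomposableD (V : nmodType) (G : int -> V -> Prop) (x y : V) :
  (forall n, G n 0) -> (forall n x y, G n x -> G n y -> G n (x + y)) ->
  decomposable G x -> decomposable G y -> decomposable G (x + y).
Proof.
move=> G0 GD [s [c [us hc ->]]] [t [e [ut he ->]]].
pose u := undup (s ++ t); have uu : uniq u by apply: undup_uniq.
have su : {subset s <= u} by move=> n; rewrite mem_undup mem_cat => ->.
have tu : {subset t <= u} by move=> n; rewrite mem_undup mem_cat orbC => ->.
rewrite -(sum_extend c us uu su) -(sum_extend e ut uu tu) -big_split /=.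
exists u; exists (fun n =>
  (if n \in s then c n else 0) + (if n \in t then e n else 0)).
by split=> // n; apply: GD; case: ifP.
Qed.

Section GradedModules.
Variables (A : comNzRingType) (m : nat).
Local Notation R := {mpoly A[m]}.

Section Components.
Variable M : grmod A m.

Lemma gr_comp0 n : gr_comp n (0 : M).
Proof. by case: (gr_compP M) => h _ _ _; case: (h n). Qed.

Lemma gr_compB n (x y : M) : gr_comp n x -> gr_comp n y -> gr_comp n (x - y).
Proof. by case: (gr_compP M) => h _ _ _; case: (h n) => _; apply. Qed.

Lemma gr_compN n (x : M) : gr_comp n x -> gr_comp n (- x).
Proof. by rewrite -sub0r; apply: gr_compB; apply: gr_comp0. Qed.

Lemma gr_compD n (x y : M) : gr_comp n x -> gr_comp n y -> gr_comp n (x + y).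
Proof.
by move=> hx hy; rewrite -[y]opprK; apply: gr_compB => //; apply: gr_compN.
Qed.

Lemma gr_compZ (d : nat) (p : R) n (x : M) :
  p \is d.-homog -> gr_comp n x -> gr_comp (d%:Z + n) (p *: x).
Proof. by case: (gr_compP M) => _ h _ _; apply: h. Qed.

Lemma gr_decomp (x : M) : decomposable (@gr_comp _ _ M) x.
Proof. by case: (gr_compP M) => _ _ h _; apply: h. Qed.

Lemma gr_indep (s : seq int) (c : int -> M) :
  uniq s -> (forall n, gr_comp n (c n)) -> \sum_(n <- s) c n = 0 ->
  forall n, n \in s -> c n = 0.
Proof. by case: (gr_compP M) => _ _ _ h; apply: h. Qed.

(** Uniqueness of the decomposition: subtracting the sum in degree [n] from
    its own decomposition gives a vanishing sum of components. *)
Lemma gr_comp_sum n (s : seq int) (c : int -> M) :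
  uniq s -> (forall k, gr_comp k (c k)) -> gr_comp n (\sum_(k <- s) c k) ->
  \sum_(k <- s) c k = if n \in s then c n else 0.
Proof.
move=> us hc hn; set y := \sum_(k <- s) c k in hn *.
pose u := undup (n :: s); have uu : uniq u by apply: undup_uniq.
have nu : n \in u by rewrite mem_undup mem_head.
have su : {subset s <= u} by move=> k; rewrite mem_undup inE orbC => ->.
pose c' k := (if k \in s then c k else 0) - (if k == n then y else 0).
apply/esym/eqP; rewrite -subr_eq0; apply/eqP.
have -> : (if n \in s then c n else 0) - y = c' n by rewrite /c' eqxx.
apply: (@gr_indep u) => // [k|].
  apply: gr_compB; first by case: ifP => // _; apply: gr_comp0.
  by case: eqP => [->|_] //; apply: gr_comp0.
rewrite sumrB sum_extend // -[X in _ - X]big_mkcond -big_filter.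
have -> : [seq k <- u | k == n] = [:: n].
  by rewrite (filter_pred1_uniq uu nu).
by rewrite big_seq1 subrr.
Qed.

End Components.

(** The homogeneous component of degree [n] of any preimage works: the other
    components die, the target being a direct sum of its degrees. *)
Lemma graded_hom_lift (M N : grmod A m) (f : {linear M -> N}) n x :
  graded_hom f -> gr_comp n (f x) -> exists2 y, gr_comp n y & f y = f x.
Proof.
move=> hf; have [s [c [us hc ->]]] := gr_decomp x.
have fs : f (\sum_(k <- s) c k) = \sum_(k <- s) f (c k) by rewrite raddf_sum.
rewrite fs => hn; have hfc k : gr_comp k (f (c k)) by apply: hf.
rewrite (gr_comp_sum us hfc hn); case: ifP => _; first by exists (c n).
by exists 0; rewrite ?raddf0 //; apply: gr_comp0.
Qed.

(** * Derivations over a partial derivative *)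

Section Derivations.
Variable j : 'I_m.

Definition derivation (E : lmodType R) (D : E -> E) : Prop :=
  (forall x y, D (x + y) = D x + D y) /\
  (forall p x, D (p *: x) = p *: D x + p^`M(j) *: x).

(** Maps of degree -1. Degrees matter because injectivity is tested only
    against maps of degree 0. *)
Definition lowering (E : grmod A m) (D : E -> E) : Prop :=
  forall n x, gr_comp (n + 1) x -> gr_comp n (D x).

Lemma derivation0 (E : lmodType R) (D : E -> E) : derivation D -> D 0 = 0.
Proof.
by case=> hD _; apply: (addIr (D 0)); rewrite -hD addr0 add0r.
Qed.

Lemma derivationN (E : lmodType R) (D : E -> E) x :
  derivation D -> D (- x) = - D x.
Proof.
move=> dD; apply/eqP; rewrite -addr_eq0; case: (dD) => hD _.
by rewrite -hD addNr derivation0.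
Qed.

Lemma mderiv_derivation : @derivation (poly_grmod A m) (mderiv j).
Proof.
split=> [x y|p x]; first by rewrite mderivD.
by rewrite [LHS]mderivM addrC.
Qed.

Lemma mderiv_dhomog d (p : R) :
  p \is d.+1.-homog -> p^`M(j) \is d.-homog.
Proof.
move=> /dhomogP hp; apply/dhomogP => k.
rewrite mcoeff_msupp mcoeff_deriv => hk.
have : (k + U_(j))%MM \in msupp p.
  by rewrite mcoeff_msupp; apply: contraNneq hk => ->; rewrite mul0rn.
by move=> /hp /=; rewrite mdegD mdeg1 addn1 => -[].
Qed.

Lemma mderiv_dhomog0 (p : R) : p \is 0.-homog -> p^`M(j) = 0.
Proof.
move=> /dhomogP hp; apply/mpolyP => k; rewrite mcoeff0 mcoeff_deriv.
rewrite memN_msupp_eq0 ?mul0rn //; apply/negP => /hp /=.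
by rewrite mdegD mdeg1 addn1.
Qed.

(** In degree 0 the statement is that the derivative of a constant vanishes. *)
Lemma mderiv_lowering : @lowering (poly_grmod A m) (mderiv j).
Proof.
case=> [d|[|d]] x; first by rewrite /= addn1; apply: mderiv_dhomog.
  exact: mderiv_dhomog0.
have -> : Negz d.+1 + 1 = Negz d by rewrite !NegzE -addn1 PoszD opprD addrNK.
by move=> /= ->; rewrite mderiv0.
Qed.

(** * Jets *)

(** The module of first-order jets of [E] in the direction of 'X_k. The index
    [k] is a phantom parameter of the type: the R-module structure depends on
    it, and is inferred from it. *)
Definition jet (k : 'I_m) (E : lmodType R) : Type := (E * E)%type.

HB.instance Definition _ (k : 'I_m) (E : lmodType R) :=
  GRing.Zmodule.on (jet k E).

Section JetModule.
Variable E : lmodType R.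

Definition jet_scale (p : R) (u : jet j E) : jet j E :=
  (p *: u.1, p *: u.2 + p^`M(j) *: u.1).

Lemma jet_scaleA p q u : jet_scale p (jet_scale q u) = jet_scale (p * q) u.
Proof.
rewrite /jet_scale /= mderivM scalerDr scalerDl !scalerA.
by congr (_, _); rewrite addrAC addrA.
Qed.

Lemma jet_scale1 : left_id 1 jet_scale.
Proof.
move=> [a b]; rewrite /jet_scale /= -mpolyC1 mderivC scale0r addr0.
by rewrite mpolyC1 !scale1r.
Qed.

Lemma jet_scaleDr : right_distributive jet_scale +%R.
Proof.
move=> p [a b] [a' b']; rewrite /jet_scale /= !scalerDr.
by congr (_, _); rewrite addrACA.
Qed.

Lemma jet_scaleDl u : {morph jet_scale^~ u : p q / p + q}.
Proof.
move=> p q; rewrite /jet_scale mderivD !scalerDl /=.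
by congr (_, _); rewrite addrACA.
Qed.

HB.instance Definition _ := GRing.Zmodule_isLmodule.Build R (jet j E)
  jet_scaleA jet_scale1 jet_scaleDr jet_scaleDl.

Lemma jetZE p (u : jet j E) : p *: u = (p *: u.1, p *: u.2 + p^`M(j) *: u.1).
Proof. by []. Qed.

End JetModule.

Section JetGrading.
Variable E : grmod A m.

(** The derivative lowers degrees by 1, so the first component carries a shift:
    with it, the action of R on jets is graded, and the projection of a jet to
    its second component has degree 0. *)
Definition jet_comp (n : int) (u : jet j E) : Prop :=
  gr_comp (n + 1) u.1 /\ gr_comp n u.2.

Lemma jet_comp_sub n : jet_comp n 0 /\
  (forall u v, jet_comp n u -> jet_comp n v -> jet_comp n (u - v)).
Proof.
split; first by split; apply: gr_comp0.
by move=> u v [u1 u2] [v1 v2]; split; apply: gr_compB.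
Qed.

Lemma jet_comp0 n : jet_comp n 0. Proof. by case: (jet_comp_sub n). Qed.

Lemma jet_compD n u v : jet_comp n u -> jet_comp n v -> jet_comp n (u + v).
Proof. by move=> [u1 u2] [v1 v2]; split; apply: gr_compD. Qed.

Lemma jet_compZ (d : nat) (p : R) n u :
  p \is d.-homog -> jet_comp n u -> jet_comp (d%:Z + n) (p *: u).
Proof.
move=> hp [u1 u2]; split; rewrite jetZE /=.
  by rewrite -addrA; apply: gr_compZ.
apply: gr_compD; first exact: gr_compZ.
case: d hp => [|d] hp.
  by rewrite mderiv_dhomog0 // scale0r; apply: gr_comp0.
have -> : d.+1%:Z + n = d%:Z + (n + 1).
  by rewrite -addn1 PoszD -addrA [1 + n]addrC.
by apply: gr_compZ => //; apply: mderiv_dhomog.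
Qed.

Lemma jet_sum (s : seq int) (c : int -> jet j E) :
  \sum_(n <- s) c n = (\sum_(n <- s) (c n).1, \sum_(n <- s) (c n).2) :> jet j E.
Proof.
elim: s => [|n s IH]; first by rewrite !big_nil.
by rewrite !big_cons IH.
Qed.

Lemma jet_indep (s : seq int) (c : int -> jet j E) :
  uniq s -> (forall n, jet_comp n (c n)) -> \sum_(n <- s) c n = 0 ->
  forall n, n \in s -> c n = 0.
Proof.
move=> us hc; rewrite jet_sum => -[h1 h2] n ns.
have c2 : (c n).2 = 0.
  by apply: (gr_indep us _ h2) => // k; case: (hc k).
have c1 : (c n).1 = 0.
  (* The first components are homogeneous of degrees shifted by 1. *)
  rewrite -[n](addrK 1); pose c' k := (c (k - 1)).1.
  apply: (@gr_indep E [seq k + 1 | k <- s] c'); last exact: map_f.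
  - by rewrite map_inj_uniq //; apply: addIr.
  - by move=> k; case: (hc (k - 1)); rewrite subrK.
  - by rewrite big_map -[RHS]h1; apply: eq_bigr => k _; rewrite /c' addrK.
by case: (c n) c1 c2 => a b /= -> ->.
Qed.

End JetGrading.

(** * Jets over the image of a graded map *)

Section JetsOverImage.
Variables (M E : grmod A m) (f : {linear M -> E}) (hf : graded_hom f).

Definition over_image : {pred jet j E} :=
  fun u => boolp.asbool (exists x, f x = u.1).

Lemma over_imageP u : reflect (exists x, f x = u.1) (u \in over_image).
Proof. exact: boolp.asboolP. Qed.

Lemma over_image_closed : submod_closed over_image.
Proof.
split=> [|p u v /over_imageP[x hx] /over_imageP[y hy]].
  by apply/over_imageP; exists 0; rewrite raddf0.
by apply/over_imageP; exists (p *: x + y); rewrite linearP hx hy.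
Qed.

HB.instance Definition _ :=
  GRing.isSubmodClosed.Build R (jet j E) over_image over_image_closed.

(** A derivation known only on the image of [f] defines a linear form on
    these jets, see [derivation_extend]. *)
Record image_jet := ImageJet {
  image_jet_val :> jet j E;
  _ : image_jet_val \in over_image }.

HB.instance Definition _ := [isSub for image_jet_val].
HB.instance Definition _ := [Choice of image_jet by <:].
HB.instance Definition _ := [SubChoice_isSubLmodule of image_jet by <:].

Definition image_jet_comp (n : int) (u : image_jet) : Prop :=
  jet_comp n (val u).

(** The first component is decomposed through a preimage under [f], so that
    its homogeneous parts stay in the image of [f]. *)
Lemma image_jet_decomp (u : image_jet) : decomposable image_jet_comp u.
Proof.
have D0 n : image_jet_comp n 0 by exact: jet_comp0.
have DD n (v w : image_jet) :
    image_jet_comp n v -> image_jet_comp n w -> image_jet_comp n (v + w).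
  exact: jet_compD.
case: u => -[a b] hu; have /over_imageP[x /= hx] := hu.
have fP y e : ((f y, e) : jet j E) \in over_image.
  by apply/over_imageP; exists y.
have f0P e : ((0, e) : jet j E) \in over_image.
  by apply/over_imageP; exists 0; rewrite raddf0.
have -> : ImageJet hu = ImageJet (fP x 0) + ImageJet (f0P b).
  by apply: val_inj => /=; rewrite hx; congr (_, _); rewrite (addr0, add0r).
apply: decomposableD => //.
  have [s [c [us hc ->]]] := gr_decomp x.
  exists [seq n - 1 | n <- s]; exists (fun n => ImageJet (fP (c (n + 1)) 0)).
  split.
  - by rewrite map_inj_uniq //; apply: addIr.
  - by move=> n; split; [apply: hf | apply: gr_comp0].
  - apply: val_inj; rewrite [RHS]raddf_sum [RHS]jet_sum /=.
    congr (_, _); last by rewrite big1.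
    by rewrite big_map raddf_sum; apply: eq_bigr => n _; rewrite subrK.
have [s [c [us hc ->]]] := gr_decomp b.
exists s; exists (fun n => ImageJet (f0P (c n))); split=> //.
- by move=> n; split; first exact: gr_comp0.
- apply: val_inj; rewrite [RHS]raddf_sum [RHS]jet_sum /=.
  by congr (_, _); rewrite [RHS]big1.
Qed.

Lemma image_jet_grading : is_grading image_jet_comp.
Proof.
split.
- move=> n; split; first exact: jet_comp0.
  by move=> u v; case: (jet_comp_sub E n) => _; apply.
- by move=> d p n u hp; apply: jet_compZ.
- exact: image_jet_decomp.
- move=> s c us hc h0 n ns; apply: val_inj.
  apply: (jet_indep us hc _ ns).
  by rewrite -(raddf_sum (val : image_jet -> jet j E)) h0.
Qed.

End JetsOverImage.

Lemma jet_grading (E : grmod A m) : is_grading (@jet_comp E).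
Proof.
split; [exact: jet_comp_sub | exact: jet_compZ | | exact: jet_indep].
move=> [a b].
have [s [c [us hc ha]]] := gr_decomp a; have [t [e [ut he hb]]] := gr_decomp b.
have -> : (a, b) = ((a, 0) : jet j E) + ((0, b) : jet j E).
  by congr (_, _); rewrite (addr0, add0r).
apply: decomposableD; [exact: jet_comp0 | exact: jet_compD | |].
  exists [seq n - 1 | n <- s]; exists (fun n => (c (n + 1), 0)); split.
  - by rewrite map_inj_uniq //; apply: addIr.
  - by move=> n; split=> //; apply: gr_comp0.
  - rewrite jet_sum /= big_map ha; congr (_, _); last by rewrite big1.
    by apply: eq_bigr => n _; rewrite subrK.
exists t; exists (fun n => (0, e n)); split=> //.
- by move=> n; split=> //; apply: gr_comp0.
- by rewrite jet_sum hb; congr (_, _); rewrite [RHS]big1.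
Qed.

(** * Extension of derivations to graded injective modules *)

(** The condition on the kernel of [f] says that [D] induces a derivation of
    the image of [f]; the lemma extends it to [E]. The linear form
    (a, b) |-> b - D a on jets over the image is extended to a form [h] on all
    jets by injectivity of [E], and - h (x, 0) is the value at x of the extended
    derivation. The Leibniz rule for it is the linearity of [h] together with
    h (0, b) = b. *)
Lemma derivation_extend (M E : grmod A m) (f : {linear M -> E}) (D : M -> M) :
  graded_injective E -> graded_hom f -> derivation D -> lowering D ->
  (forall x, f x = 0 -> f (D x) = 0) ->
  exists D' : E -> E,
    [/\ derivation D', lowering D' & forall x, D' (f x) = f (D x)].
Proof.
move=> injE hf dD lD kerD; have [DD DZ] := dD.
pose J := GrMod (jet_grading E); pose U := GrMod (image_jet_grading hf).
have DE x y : f x = f y -> f (D x) = f (D y).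
  move=> fxy; apply/eqP; rewrite -subr_eq0 -raddfB -(derivationN _ dD) -DD.
  by apply/eqP/kerD; rewrite raddfB /= fxy subrr.
pose pre (u : U) := projT1 (boolp.cid (over_imageP f _ (valP u))).
have preE u : f (pre u) = (val u).1.
  by rewrite /pre; case: (boolp.cid _).
pose g0 (u : U) : E := (val u).2 - f (D (pre u)).
have g0E u x : f x = (val u).1 -> g0 u = (val u).2 - f (D x).
  by move=> hx; rewrite /g0 (DE _ x) // preE.
have g_lin : linear g0.
  move=> p u v; rewrite (@g0E (p *: u + v) (p *: pre u + pre v)); last first.
    by rewrite linearP !preE.
  have -> : (val (p *: u + v)).2 =
      p *: (val u).2 + p^`M(j) *: (val u).1 + (val v).2 by [].
  rewrite DD DZ linearD linearP linearZ_LR preE /g0 /=.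
  by rewrite scalerBr opprD addrACA opprD [X in X + _]addrACA subrr addr0.
pose gL := GRing.isLinear.Build _ _ _ _ g0 g_lin.
pose g : {linear U -> E} := HB.pack g0 gL.
have v_lin : linear (val : U -> J) by [].
pose vL := GRing.isLinear.Build _ _ _ _ (val : U -> J) v_lin.
pose v : {linear U -> J} := HB.pack (val : U -> J) vL.
have gv : graded_hom v by [].
have gg : graded_hom g.
  move=> n u [u1 u2]; rewrite -preE in u1.
  have [y hy fy] := graded_hom_lift hf u1.
  rewrite /= (@g0E _ y) ?fy ?preE //; apply: gr_compB => //.
  by apply/hf/lD.
have [h gh hE] := injE _ _ v g gv val_inj gg.
have h2 b : h ((0, b) : jet j E) = b.
  have ub : ((0, b) : jet j E) \in over_image f.
    by apply/over_imageP; exists 0; rewrite raddf0.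
  have -> := hE (ImageJet ub); rewrite /= (@g0E _ 0) ?raddf0 //=.
  by rewrite derivation0 // raddf0 subr0.
exists (fun x => - h ((x, 0) : jet j E)); split; last first.
- move=> x; have ux : ((f x, 0) : jet j E) \in over_image f.
    by apply/over_imageP; exists x.
  by have -> := hE (ImageJet ux); rewrite /= (@g0E _ x) //= sub0r opprK.
- move=> n x hx; apply/gr_compN/gh.
  by split=> //; apply: gr_comp0.
split=> [x y|p x].
  rewrite -opprD -raddfD; congr (- h _).
  by congr (_, _); rewrite addr0.
(* The Leibniz term is the correction (p x, 0) = p (x, 0) - (0, p' x). *)
have -> : ((p *: x, 0) : jet j E) =
    p *: ((x, 0) : jet j E) - ((0, p^`M(j) *: x) : jet j E).
  by congr (_, _) => /=; rewrite ?subr0 // scaler0 add0r subrr.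
by rewrite linearB linearZ_LR h2 opprB scalerN addrC.
Qed.

(** * The action on local cohomology *)

(** For an ideal I this says that the derivative maps I^(k+1) into I^k, tested
    on an element killed by I^k; arguing on x avoids sums of elements of I^k.
    For a product a b with a in I and b
    in I^k, the term (da) b kills x because b does; for a (db), the induction
    hypothesis is applied to a x, which is killed by I^(k-1). *)
Lemma mderiv_ideal_exp (I : R -> Prop) (E : lmodType R) k (x : E) :
  (forall p, ideal_exp I k p -> p *: x = 0) ->
  forall p, ideal_exp I k.+1 p -> p^`M(j) *: x = 0.
Proof.
elim: k x => [|k IH] x hx p [n [a [b [ha hb ->]]]].
  by rewrite -(scale1r x) (hx 1) // scaler0.
rewrite raddf_sum scaler_suml big1 // => l _.
rewrite /= mderivM scalerDl -!scalerA (hx _ (hb l)) scaler0 add0r.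
rewrite scalerA mulrC -scalerA; apply: (IH _ _ _ (hb l)) => q hq.
rewrite scalerA mulrC; apply: hx; exists 1%N, (fun=> a l), (fun=> q).
by split=> //; rewrite big_ord1.
Qed.

(** Each generator a b of I^(k+1), with b in I^k, kills x because b does. *)
Lemma ideal_exp_kill_leq (I : R -> Prop) (E : lmodType R) k l (x : E) :
  (k <= l)%N -> (forall p, ideal_exp I k p -> p *: x = 0) ->
  forall p, ideal_exp I l p -> p *: x = 0.
Proof.
move=> /subnK <-; elim: (l - k)%N => // e IH hx p [n [a [b [_ hb ->]]]].
rewrite scaler_suml big1 // => i _.
by rewrite -scalerA (IH hx _ (hb i)) scaler0.
Qed.

Lemma torsionP (I : R -> Prop) (E : lmodType R) p (x y : E) :
  torsion I x -> torsion I y -> torsion I (p *: x + y).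
Proof.
move=> [k hx] [l hy]; exists (maxn k l) => q hq.
rewrite scalerDr scalerA mulrC -scalerA.
rewrite (ideal_exp_kill_leq (leq_maxl k l) hx hq) scaler0 add0r.
exact: (ideal_exp_kill_leq (leq_maxr k l) hy hq).
Qed.

(** For p in I^(k+1), p D x = D (p x) - (dp) x, and both terms vanish when I^k
    kills x. *)
Lemma derivation_torsion (I : R -> Prop) (E : lmodType R) (D : E -> E) x :
  derivation D -> torsion I x -> torsion I (D x).
Proof.
move=> dD [k hx]; exists k.+1 => p hp; have [_ DZ] := dD.
have px : p *: x = 0.
  case: hp => n [a [b [_ hb ->]]]; rewrite scaler_suml big1 // => l _.
  by rewrite -scalerA (hx _ (hb l)) scaler0.
have := DZ p x; rewrite px derivation0 // (mderiv_ideal_exp hx hp) addr0.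
by move=> <-.
Qed.

Section Resolution.
Variables (N : grmod A m) (E : nat -> grmod A m).
Variables (eps : {linear N -> E 0}) (d : forall k, {linear E k -> E k.+1}).
Variables (delta : N -> N).
Hypotheses (ddelta : derivation delta) (ldelta : lowering delta).
Hypothesis res : graded_injective_resolution eps d.

(** Stability of the kernel of [d k] is what makes the derivation induced on
    the image of [d k] well defined, and is carried along the induction. *)
Definition cocycle_derivation k (D : E k -> E k) : Prop :=
  [/\ derivation D, lowering D & forall x, d k x = 0 -> d k (D x) = 0].

Lemma cocycle_derivationS k (D : E k -> E k) :
  cocycle_derivation D -> exists2 D' : E k.+1 -> E k.+1,
    cocycle_derivation D' & forall x, D' (d k x) = d k (D x).
Proof.
case: res => injE [_ gd] _ _ exd [dD lD kD].
have [D' [dD' lD' D'E]] := derivation_extend (injE k.+1) (gd k) dD lD kD.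
exists D' => //; split=> // x /exd[y <-].
by rewrite D'E; apply/exd; exists (D y).
Qed.

Lemma cocycle_derivation_exists k : exists D : E k -> E k, cocycle_derivation D.
Proof.
elim: k => [|k [D /cocycle_derivationS[D' hD' _]]]; last by exists D'.
case: res => injE [geps _] inj_eps ex0 _.
have keps x : eps x = 0 -> eps (delta x) = 0.
  rewrite -[RHS](raddf0 eps) => /inj_eps ->.
  by rewrite derivation0 // raddf0.
have [D [dD lD DE]] := derivation_extend (injE 0) geps ddelta ldelta keps.
exists D; split=> // x /ex0[y <-].
by rewrite DE; apply/ex0; exists (delta y).
Qed.

(** Coboundaries in degree k+1 involve the derivations of [E k] and [E k.+1]
    at once, so the second is chosen as an extension of what the first
    forces. *)
Lemma torsion_complex_derivation (I : R -> Prop) k :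
  exists D : E k -> E k,
    [/\ derivation D,
        forall x, torsion_cocycle I d x -> torsion_cocycle I d (D x) &
        forall x, torsion_coboundary I d x -> torsion_coboundary I d (D x)].
Proof.
case: k => [|k].
  have [D [dD _ kD]] := cocycle_derivation_exists 0; exists D; split=> //.
    by move=> x [tx dx]; split; [apply: derivation_torsion | apply: kD].
  by move=> x /= ->; apply: derivation0.
have [D hD] := cocycle_derivation_exists k.
have [D' [dD' _ kD'] D'E] := cocycle_derivationS hD; exists D'; split=> //.
  by move=> x [tx dx]; split; [apply: derivation_torsion | apply: kD'].
move=> _ [y ty <-]; exists (D y); last by rewrite D'E.
by case: hD => dD _ _; apply: derivation_torsion.
Qed.

End Resolution.

(** [pi] is controlled on cocycles only, so the operator is defined by choosing
    a cocycle above each class; it does not depend on the choice because the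
    derivation of the complex preserves coboundaries. *)
Lemma local_cohomology_derivation (I : R -> Prop) i (N H : grmod A m)
    (delta : N -> N) :
  derivation delta -> lowering delta -> is_local_cohomology I i N H ->
  exists D : H -> H, derivation D.
Proof.
move=> dd ld [E [eps [d [pi [res [pi_lin pi_surj pi_ker _]]]]]].
have [D [[DD DZ] coD cobD]] := torsion_complex_derivation dd ld res I i.
pose coc := @torsion_cocycle _ _ I E d i.
pose rep z := s2val (boolp.cid2 (pi_surj z)).
have repC z : coc (rep z) by rewrite /rep; case: (boolp.cid2 _).
have repE z : pi (rep z) = z by rewrite /rep; case: (boolp.cid2 _).
have coc0 : coc 0 by split; [exists 0 => p _; rewrite scaler0 | rewrite raddf0].
have pi0 : pi 0 = 0.
  have := pi_lin 1 0 0 coc0 coc0; rewrite !scale1r addr0.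
  by rewrite -[LHS]addr0 => /addrI.
have cocP p x y : coc x -> coc y -> coc (p *: x + y).
  move=> [tx dx] [ty dy]; split; last by rewrite linearP /= dx dy scaler0 addr0.
  exact: torsionP.
have derivN1 : (-1 : R)^`M(j) = 0 by rewrite mderivN -mpolyC1 mderivC oppr0.
have DE x z : coc x -> pi x = z -> pi (D (rep z)) = pi (D x).
  move=> cx xz; have cz := repC z.
  have cDz := coD _ cz; have cDx := coD _ cx.
  have /cobD : torsion_coboundary I d (-1 *: rep z + x).
    apply/(pi_ker _ (cocP _ _ _ cz cx)).
    by rewrite pi_lin // repE xz scaleN1r addNr.
  rewrite DD DZ derivN1 scale0r addr0 => /(pi_ker _ (cocP _ _ _ cDz cDx)).
  by rewrite pi_lin // scaleN1r addrC => /subr0_eq ->.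
exists (fun z => pi (D (rep z))); split=> [y z|p z] /=.
  have c1 : coc (1 *: rep y + rep z) by apply: cocP.
  have [cDy cDz] := (coD _ (repC y), coD _ (repC z)).
  rewrite (DE _ (y + z) c1).
    by rewrite scale1r DD -[X in pi (X + _)]scale1r pi_lin // scale1r.
  by rewrite (pi_lin _ _ _ (repC y) (repC z)) !repE scale1r.
have cz := repC z; have cDz := coD _ cz.
have cZ q : coc (q *: rep z) by rewrite -[X in coc X]addr0; apply: cocP.
rewrite (DE _ (p *: z) (cZ p)); last first.
  by rewrite -[X in pi X]addr0 pi_lin // pi0 addr0 repE.
rewrite DZ (pi_lin _ _ _ cDz (cZ _)); congr (_ + _).
by rewrite -[X in pi X]addr0 pi_lin // pi0 addr0 repE.
Qed.

(** If X^(k+1) kills E, applying [D] to X^(k+1) y = 0 leaves (k+1) X^k y = 0. *)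
Lemma derivation_nilpotent_eq0 (E : lmodType R) (D : E -> E) k :
  derivation D -> (forall n (x : E), x *+ n.+1 = 0 -> x = 0) ->
  (forall x : E, 'X_j ^+ k *: x = 0) -> forall x : E, x = 0.
Proof.
move=> dD tf; have [_ DZ] := dD; elim: k => [|k IH] hX x.
  by rewrite -[x]scale1r -(expr0 'X_j) hX.
apply: IH => y; apply: (tf k).
have := DZ ('X_j ^+ k.+1) y; rewrite !hX derivation0 // add0r.
rewrite mpolyXn mderivX mulmnE mnm1E eqxx mul1n.
have -> : (U_(j) *+ k.+1 - U_(j))%MM = (U_(j) *+ k)%MM.
  by apply/mnmP => l; rewrite mnmBE !mulmnE mulnS addKn.
by rewrite -mpolyXn -mul_mpolyC mpolyC_nat -scalerA scaler_nat => <-.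
Qed.

End Derivations.
End GradedModules.

(** * Vanishing of modules with finitely many degrees *)

(** A positive integer is invertible in the field of characteristic 0. *)
Lemma natr_torsion_free (A : comNzRingType) (m : nat)
    (M : lmodType {mpoly A[m]}) n (x : M) :
  contains_field_char0 A -> x *+ n.+1 = 0 -> x = 0.
Proof.
move=> [K [phi /pcharf0P char0]] hx.
have nz : n.+1%:R != 0 :> K by rewrite char0.
rewrite -[x]scale1r -mpolyC1 -(rmorph1 phi) -(mulVf nz) rmorphM mpolyCM.
by rewrite -scalerA rmorph_nat mpolyC_nat scaler_nat hx scaler0.
Qed.

(** The nonzero degrees lie in the interval [-n0, n0], of length 2 n0, so a
    shift by 2 n0 + 1 leaves it. *)
Lemma bounded_nilpotent (A : comNzRingType) (m : nat) (M : grmod A m)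
    (j : 'I_m) n0 :
  (forall n : int, (n0 < `|n|)%N -> forall x : M, gr_comp n x -> x = 0) ->
  forall x : M, 'X_j ^+ n0.*2.+1 *: x = 0.
Proof.
move=> h x; have [s [c [_ hc ->]]] := gr_decomp x.
rewrite scaler_sumr big1 // => n _.
have [|le_n] := ltnP n0 `|n|%N.
  by move/h => /(_ _ (hc n)) ->; rewrite scaler0.
apply: (h (n0.*2.+1%:Z + n)); first by lia.
apply: gr_compZ => //.
rewrite -[X in X.-homog]mul1n; apply: dhomogMn.
by rewrite dhomogX /= mdeg1.
Qed.

Theorem theorem1p2 (A : comNzRingType) (m : nat) (I : {mpoly A[m]} -> Prop)
    (i : nat) (M : grmod A m) :
  regular_ring A ->
  contains_field_char0 A ->
  (1 <= m)%N ->
  homogeneous_ideal I ->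
  is_local_cohomology I i (poly_grmod A m) M ->
  (exists n0 : nat, forall n : int, (n0 < `|n|)%N ->
     forall x : M, gr_comp n x -> x = 0) ->
  forall x : M, x = 0.
Proof.
move=> _ char0 m_gt0 _ cohM [n0 bounded].
pose j := Ordinal m_gt0.
have [D dD] := local_cohomology_derivation (@mderiv_derivation A m j)
  (@mderiv_lowering A m j) cohM.
apply: (derivation_nilpotent_eq0 dD) (bounded_nilpotent j bounded).
by move=> n x; apply: natr_torsion_free.
Qed.
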